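(* Let $\rho$ be a random variable with values in $(-1, 1)$ and let $C(u, v) = \operatorname{E}[C_\rho(u, v)]$, $(u, v) \in [0, 1]^2$, where for $r \in (-1,1)$, $C_r$ denotes the bivariate Gaussian copula with correlation $r$ and the expectation is with respect to $\rho$. Let $\lambda(u) = u^{-1} \, C(u, u)$ for $0 < u \le 1$. If $\rho < 1$ almost surely but the upper endpoint of the distribution of $\rho$ is equal to $1$, then for every $\varepsilon > 0$, \[ \lim_{u \downarrow 0} u^{-\varepsilon} \, \lambda(u) = \infty. \] As a consequence, although $\lambda = \lim_{u \downarrow 0} \lambda(u) = 0$ (asymptotic independence), the Ledford--Tawn index of $C$ is equal to $\eta = 1$; likewise, $\bar{\chi} = 1$.
   Context: Equivalently, $C$ is the copula of $(X, Y)$ where $X, Z, \rho$ are independent, $X$ and $Z$ are standard normal, and $Y = \rho X + (1 - \rho^2)^{1/2} Z$. The upper endpoint of the distribution of $\rho$ is $\sup\{x : \Pr(\rho \le x) < 1\}$; it equals $1$ if and only if (given $\rho<1$ a.s.) $\Pr(\rho > x) > 0$ for every $x < 1$. The Ledford--Tawn index of a copula $C$ is $\eta = \lim_{u \downarrow 0} \frac{\log u}{\log C(u, u)}$, when the limit exists, and $\bar{\chi} = 2 \eta - 1$. *)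

(* Defs.v *)
(* MathComp-Analysis. *)
From HB Require Import structures.
From mathcomp Require Import all_boot all_order all_algebra.
From mathcomp Require Import all_classical all_reals all_analysis.

Set Implicit Arguments.
Unset Strict Implicit.
Unset Printing Implicit Defensive.

Import Order.TTheory GRing.Theory Num.Theory.
Import numFieldNormedType.Exports.

Local Open Scope classical_set_scope.
Local Open Scope ring_scope.

(* The generalized inverse inf {x | u <= Phi x}, valued in the extended reals
   so that the quantiles of 0 and 1 are -oo and +oo. *)
Definition std_normal_quantile (R : realType) (u : R) : \bar R :=
  ereal_inf [set x%:E | x in
    [set x : R | (u%:E <= normal_prob (0 : R) 1 `]-oo, x])%E]].

(* The centered bivariate normal law with unit variances and correlation r:
   the law of (X, r X + sqrt (1 - r^2) Z) for independent standard normal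
   X and Z. *)
Definition binormal (R : realType) (r : R) : set (R * R) -> \bar R :=
  pushforward (normal_prob (0 : R) 1 \x normal_prob (0 : R) 1)%E
    (fun xz : R * R => (xz.1, r * xz.1 + Num.sqrt (1 - r ^+ 2) * xz.2)).

Definition gaussian_copula (R : realType) (r u v : R) : R :=
  fine (binormal r [set xy : R * R |
    (xy.1%:E <= std_normal_quantile u)%E /\
    (xy.2%:E <= std_normal_quantile v)%E]).

Definition mixture_copula d (Omega : measurableType d) (R : realType)
    (P : probability Omega R) (rho : {RV P >-> R}) (u v : R) : R :=
  fine 'E_P[fun w => gaussian_copula (rho w) u v].

Definition upper_endpoint d (Omega : measurableType d) (R : realType)
    (P : probability Omega R) (X : {RV P >-> R}) : \bar R :=
  ereal_sup [set x%:E | x in [set x : R | (cdf X x < 1)%E]].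

Definition tail_ratio (R : realType) (C : R -> R -> R) (u : R) : R :=
  u^-1 * C u u.

Definition ledford_tawn_ratio (R : realType) (C : R -> R -> R) (u : R) : R :=
  ln u / ln (C u u).

(* These are meaningful only when ledford_tawn_ratio C converges at 0^'+. *)
Definition ledford_tawn_index (R : realType) (C : R -> R -> R) : R :=
  lim (ledford_tawn_ratio C u @[u --> 0^'+]).

Definition chi_bar (R : realType) (C : R -> R -> R) : R :=
  2 * ledford_tawn_index C - 1.

(* Main.v *)
Require Import Defs.
From HB Require Import structures.
From mathcomp Require Import all_boot all_order all_algebra.
From mathcomp Require Import all_classical all_reals all_analysis.
From mathcomp Require Import measurable_realfun ring lra.

Set Implicit Arguments.
Unset Strict Implicit.
Unset Printing Implicit Defensive.

Import Order.TTheory GRing.Theory Num.Theory.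
Import numFieldNormedType.Exports.

Local Open Scope classical_set_scope.
Local Open Scope ring_scope.

(* Put u = T t with T t := Pr(Z > t), so that the quantile of u is -t and
   u -> 0 amounts to t -> +oo; T is bracketed by
   peak * exp(-(t+1)^2/2) <= T t <= exp(-t^2/2).
   If r >= r0 > 0, the copula event {X <= -t, r X + s Z <= -t} contains
   {X <= -t/r0, Z <= 0}, whence C(u, u) >= Pr(rho > r0) T(t/r0) T(0).  Choosing
   r0^-2 = 1 + eps/2, this is of larger order than u^(1+eps).
   For fixed r < 1, splitting the event at X = -m t with m > 1 and r m < 1 gives
   C_r(u, u) <= T(m t) + T(t) T(c t) with c > 0, which is o(u); dominated
   convergence then gives C(u, u) = o(u).  The Ledford-Tawn index follows from
   u^(1+eps) <= C(u, u) <= u. *)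

(** * Bounds and regularity of the normal tail *)

Definition normal_tail (R : realType) (t : R) : R :=
  fine (normal_prob 0 1 `]-oo, (- t)]).

Lemma normal_tailE (R : realType) (t : R) :
  normal_prob 0 1 `]-oo, (- t)] = (normal_tail t)%:E.
Proof. by rewrite /normal_tail fineK// fin_num_measure. Qed.

Lemma normal_tail_ge0 (R : realType) (t : R) : 0 <= normal_tail t.
Proof. by rewrite -lee_fin -normal_tailE. Qed.

Lemma normal_pdf_homo_npos (R : realType) (x y : R) : x <= y -> y <= 0 ->
  normal_pdf 0 1 x <= normal_pdf 0 1 y.
Proof.
move=> xy y0; rewrite !normal_pdfE ?oner_neq0//.
rewrite ler_pM2l ?normal_peak_gt0 ?oner_neq0// /normal_fun ler_expR.
rewrite !subr0 ler_pM2r ?invr_gt0//.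
nra.
Qed.

(** The difference is the mass of the interval from [- t] to [- s], where the density is
    nondecreasing and so lies between its endpoint values. Lower bound, strict decrease and
    Lipschitz continuity of the tail all come from here. *)
Lemma normal_tailB_bounds (R : realType) (s t : R) : 0 <= s -> s <= t ->
  normal_pdf 0 1 (- t) * (t - s) <= normal_tail s - normal_tail t
    <= normal_pdf 0 1 (- s) * (t - s).
Proof.
move=> s0 st.
have E : (normal_tail s)%:E =
    ((normal_tail t)%:E + normal_prob 0 1 `](- t)%R, (- s)%R])%E.
  rewrite -!normal_tailE -measureU//.
    by congr (normal_prob _ _ _); rewrite -itv_bndbnd_setU// bnd_simp lerN2.
  by apply/seteqP; split => x //=; rewrite !in_itv/=; lra.
have mu : lebesgue_measure `](- t)%R, (- s)%R] = (t - s)%:E.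
  rewrite lebesgue_measure_itv/= lte_fin ltrN2.
  case: (ltP s t) => ts; last first.
    have -> : t = s by apply/eqP; rewrite eq_le ts st. by rewrite subrr.
  by rewrite -EFinD opprK addrC.
rewrite -!lee_fin EFinB E [((normal_tail t)%:E + _)%E]addeC addeK//.
rewrite !EFinM -mu -!integral_cst// /normal_prob. 
have mpdf : measurable_fun `](- t), (- s)] (fun x : R => (normal_pdf 0 1 x)%:E).
  apply/measurable_EFinP; apply: measurable_funTS.
  exact: measurable_normal_pdf.
by apply/andP; split; apply: ge0_le_integral => //= x;
  rewrite ?in_itv/= ?lee_fin ?normal_pdf_ge0// => /andP[tx xs];
  apply: normal_pdf_homo_npos; lra.
Qed.

(** Exponential tilting: for [x <= - t] one has [x ^+ 2 >= (x + t) ^+ 2 + t ^+ 2], so the density is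
    at most exp(-t^2/2) times the normal density of mean [- t], whose total mass is 1. *)
Lemma normal_tail_le (R : realType) (t : R) : 0 <= t ->
  normal_tail t <= expR (- (t ^+ 2 / 2)).
Proof.
move=> t0; rewrite -lee_fin -normal_tailE /normal_prob.
have mpdf (D : set R) m : measurable_fun D (fun x : R => (normal_pdf m 1 x)%:E).
  apply/measurable_EFinP; apply: measurable_funTS.
  exact: measurable_normal_pdf.
apply: (@le_trans _ _ (\int[lebesgue_measure]_(x in `]-oo, (- t)%R])
    ((expR (- (t ^+ 2 / 2)))%:E * (normal_pdf (- t) 1 x)%:E))%E).
  apply: ge0_le_integral => //=.
  - by move=> x _; rewrite lee_fin normal_pdf_ge0.
  - exact: mpdf.
  - by apply: emeasurable_funM => //; exact: mpdf.
  - move=> x; rewrite in_itv/= lee_fin => xt.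
    rewrite !normal_pdfE ?oner_neq0// mulrCA.
    rewrite ler_pM2l ?normal_peak_gt0 ?oner_neq0// /normal_fun -expRD ler_expR.
    rewrite expr1n subr0 opprK; nra.
rewrite -[leRHS]mule1 -(integral_normal_pdf (- t) 1).
rewrite ge0_integralZl//; first last.
- by move=> x _; rewrite lee_fin normal_pdf_ge0.
- exact: mpdf.
rewrite lee_pmul2l ?lte_fin ?expR_gt0//.
apply: ge0_subset_integral => //; first exact: mpdf.
by move=> x _; rewrite lee_fin normal_pdf_ge0.
Qed.

(** Keeps only the mass of an interval of length one, bounded below by the density at its far end
    [- (t + 1)]. *)
Lemma normal_tail_ge (R : realType) (t : R) : 0 <= t ->
  normal_peak 1 * expR (- ((t + 1) ^+ 2 / 2)) <= normal_tail t.
Proof.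
move=> t0; have tt : t <= t + 1 by rewrite lerDl.
have /andP[+ _] := normal_tailB_bounds t0 tt.
rewrite normal_pdfE ?oner_neq0// /normal_fun subr0 sqrrN expr1n.
have -> : t + 1 - t = 1 by ring.
rewrite mulr1 mulNr; have := normal_tail_ge0 (t + 1); lra.
Qed.

Lemma normal_tail_gt0 (R : realType) (t : R) : 0 <= t -> 0 < normal_tail t.
Proof.
move=> t0; apply: lt_le_trans (normal_tail_ge t0).
by rewrite mulr_gt0 ?expR_gt0// normal_peak_gt0 ?oner_neq0.
Qed.

Lemma normal_tail_decr (R : realType) (s t : R) : 0 <= s -> s < t ->
  normal_tail t < normal_tail s.
Proof.
move=> s0 st; have /andP[+ _] := normal_tailB_bounds s0 (ltW st).
rewrite -[normal_tail t < _]subr_gt0; apply: lt_le_trans.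
rewrite mulr_gt0 ?subr_gt0// normal_pdfE ?oner_neq0//.
by rewrite mulr_gt0 ?expR_gt0// normal_peak_gt0 ?oner_neq0.
Qed.

Lemma normal_tail_lipschitz (R : realType) (s t : R) : 0 <= s -> 0 <= t ->
  `|normal_tail s - normal_tail t| <= normal_peak 1 * `|s - t|.
Proof.
wlog st : s t / s <= t.
  move=> H s0 t0; have [st|/ltW ts] := leP s t; first exact: H.
  by rewrite distrC (distrC s); exact: H.
move=> s0 t0; have /andP[] := normal_tailB_bounds s0 st.
have h1 := normal_pdf_ub 0 (- s) (oner_neq0 R).
have h2 := normal_pdf_ge0 0 1 (- t).
have h3 := normal_pdf_ge0 0 1 (- s).
move=> h4 h5; rewrite ger0_norm; last nra.
by rewrite distrC ger0_norm ?subr_ge0//; nra.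
Qed.

Lemma continuous_normal_tail (R : realType) (t : R) : 0 < t ->
  {for t, continuous (@normal_tail R)}.
Proof.
move=> t0; apply/cvgrPdist_le => e e0.
have p0 : 0 < normal_peak (1 : R) by rewrite normal_peak_gt0 ?oner_neq0.
near=> s.
have s0 : 0 < s by near: s; exact: lt_nbhsr.
apply: le_trans (normal_tail_lipschitz (ltW t0) (ltW s0)) _.
rewrite mulrC -ler_pdivlMr//.
by near: s; apply: cvgr_dist_le; [exact: cvg_id|rewrite divr_gt0].
Unshelve. all: by end_near. Qed.

(** What holds at [normal_tail t] for all large [t] must hold at every small [u > 0]. This needs
    each such [u] to be attained at a large argument, which the intermediate value theorem
    provides. *)
Lemma cvg_at_right_normal_tail (R : realType) :
  0^'+ `=>` @normal_tail R t @[t --> +oo].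
Proof.
move=> P [M [_ HM]].
pose M' := Num.max M 0 + 1.
have [M0 MM] : 0 < M' /\ M < M'.
  have := le_max M M 0; have := le_max 0 M 0; rewrite !lexx orbT /= /M'; lra.
near=> u.
have u0 : 0 < u by near: u; exact: nbhs_right_gt.
have uM : u < normal_tail M'.
  by near: u; apply: nbhs_right_lt; apply: normal_tail_gt0; lra.
(* As [T] is at least 2 and at least [- ln u], T^2/2 >= T >= -ln u, so the exponential bound puts
   [normal_tail T] below [u]. *)
pose T := M' + 2 + `|ln u|.
have lu := ler_norm (- ln u); rewrite normrN in lu.
have lu0 := normr_ge0 (ln u).
have MT : M' <= T by rewrite /T; lra.
have TU : normal_tail T <= u.
  apply: le_trans (normal_tail_le _) _; first lra.
  by rewrite -[leRHS]lnK ?posrE// ler_expR /T; nra.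
have [||c] := @IVT R (@normal_tail R) M' T u MT.
- apply: continuous_in_subspaceT => x; rewrite inE/= in_itv/= => /andP[Mx _].
  by apply: continuous_normal_tail; lra.
- rewrite ge_min le_max TU (ltW uM) orbT//.
rewrite in_itv/= => /andP[Mc _] <-; apply: HM; lra.
Unshelve. all: by end_near. Qed.

(** The infimum is attained at [- t]: by strict decrease of the tail, any point to the left of [- t]
    has a smaller distribution function. *)
Lemma std_normal_quantile_normal_tail (R : realType) (t : R) : 0 <= t ->
  std_normal_quantile (normal_tail t) = (- t)%:E.
Proof.
move=> t0; apply/eqP; rewrite eq_le; apply/andP; split.
  by apply: ereal_inf_lbound; exists (- t) => //=; rewrite normal_tailE.
apply: le_ereal_inf_tmp => _ [x /= + <-]; rewrite lee_fin.
rewrite -{1}(opprK x) normal_tailE lee_fin; apply: contraLR.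
rewrite -!ltNge => xt.
by apply: normal_tail_decr => //; lra.
Qed.

(** * The Gaussian copula on the diagonal *)

(* Packaged as a probability: inference finds no finite or sigma-finite
   structure on the bare product measure. *)
Definition std_normal2 (R : realType) : probability _ R :=
  (normal_prob (0 : R) 1 \x normal_prob (0 : R) 1)%E.

Lemma std_normal2X (R : realType) (A B : set R) :
  measurable A -> measurable B ->
  std_normal2 R (A `*` B) = (normal_prob 0 1 A * normal_prob 0 1 B)%E.
Proof. by move=> mA mB; exact: product_measure1E. Qed.

Definition copula_event (R : realType) (t r : R) : set (R * R) :=
  [set xz : R * R |
    xz.1 <= - t /\ r * xz.1 + Num.sqrt (1 - r ^+ 2) * xz.2 <= - t].

Lemma gaussian_copula_tail (R : realType) (r t : R) : 0 <= t ->
  gaussian_copula r (normal_tail t) (normal_tail t) =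
  fine (std_normal2 R (copula_event t r)).
Proof.
move=> t0; rewrite /gaussian_copula /binormal.
by rewrite std_normal_quantile_normal_tail//.
Qed.

(** Measurability is joint in the correlation and the pair: sections then give both the
    measurability of each event and that of its probability as a function of [r], which is needed to
    integrate over [rho]. *)
Lemma measurable_copula_events (R : realType) (t : R) :
  measurable [set rxz : R * (R * R) | copula_event t rxz.1 rxz.2].
Proof.
pose f (rxz : R * (R * R)) : R :=
  rxz.1 * rxz.2.1 + Num.sqrt (1 - rxz.1 ^+ 2) * rxz.2.2.
have m21 : measurable_fun setT (fun rxz : R * (R * R) => rxz.2.1).
  exact: measurableT_comp measurable_fst measurable_snd.
have m22 : measurable_fun setT (fun rxz : R * (R * R) => rxz.2.2).
  exact: measurableT_comp measurable_snd measurable_snd.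
have m1 : measurable_fun setT (fun rxz : R * (R * R) => rxz.1).
  exact: measurable_fst.
have mf : measurable_fun setT f.
  apply: measurable_funD; apply: measurable_funM => //.
  have ms : measurable_fun setT (@Num.sqrt R).
    by apply: continuous_measurable_fun; exact: sqrt_continuous.
  apply: (measurableT_comp ms).
  by apply: measurable_funB => //; apply: measurable_funX.
rewrite [X in measurable X](_ : _ =
    (setT `&` [set rxz | rxz.2.1 <= - t]) `&`
    (setT `&` [set rxz | f rxz <= - t])).
  by apply: measurableI; apply: measurable_fun_le.
by rewrite !setTI.
Qed.

Lemma copula_event_xsectionE (R : realType) (t r : R) :
  copula_event t r =
  xsection [set rxz : R * (R * R) | copula_event t rxz.1 rxz.2] r.
Proof. by apply/seteqP; split => z; rewrite xsectionP. Qed.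

Lemma measurable_copula_event (R : realType) (t r : R) :
  measurable (copula_event t r).
Proof.
rewrite copula_event_xsectionE; apply: measurable_xsection.
exact: measurable_copula_events.
Qed.

Lemma measurable_gaussian_copula_tail (R : realType) (t : R) : 0 <= t ->
  measurable_fun setT
    (fun r => gaussian_copula r (normal_tail t) (normal_tail t)).
Proof.
move=> t0.
under eq_fun do rewrite gaussian_copula_tail// copula_event_xsectionE.
apply: (measurableT_comp (fine_measurable _)).
  exact: measurableT.
exact: (@measurable_fun_xsection _ _ _ _ _ (std_normal2 R) _
  (measurable_copula_events t)).
Qed.

Lemma gaussian_copula_tailE (R : realType) (r t : R) : 0 <= t ->
  (gaussian_copula r (normal_tail t) (normal_tail t))%:E =
  std_normal2 R (copula_event t r).
Proof.
move=> t0; rewrite gaussian_copula_tail// fineK// fin_num_measure//.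
exact: measurable_copula_event.
Qed.

Lemma gaussian_copula_tail_ge0 (R : realType) (r t : R) : 0 <= t ->
  0 <= gaussian_copula r (normal_tail t) (normal_tail t).
Proof. by move=> t0; rewrite -lee_fin gaussian_copula_tailE. Qed.

Lemma gaussian_copula_tail_le (R : realType) (r t : R) : 0 <= t ->
  gaussian_copula r (normal_tail t) (normal_tail t) <= normal_tail t.
Proof.
move=> t0; rewrite -lee_fin gaussian_copula_tailE// -normal_tailE.
rewrite -[leRHS]mule1 -(@probability_setT _ _ _ (normal_prob (0 : R) 1)).
rewrite -std_normal2X//; apply: le_measure; rewrite ?inE.
- exact: measurable_copula_event.
- exact: measurableX.
- by move=> [x z] [/= xt _]; split => //=; rewrite in_itv.
Qed.

(** On the rectangle [x <= - t / r0], [z <= 0], the sign of [x] gives [r * x <= r0 * x <= - t], and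
    the [z] term only helps. The bound is uniform in [r >= r0], as the mixture requires. *)
Lemma gaussian_copula_tail_ge (R : realType) (r0 r t : R) : 0 <= t ->
  0 < r0 -> r0 <= r -> r0 <= 1 ->
  normal_tail (t / r0) * normal_tail 0 <=
  gaussian_copula r (normal_tail t) (normal_tail t).
Proof.
move=> t0 r00 r0r r01.
rewrite -lee_fin gaussian_copula_tailE// EFinM -!normal_tailE.
rewrite -std_normal2X//.
apply: le_measure; rewrite ?inE.
- exact: measurableX.
- exact: measurable_copula_event.
move=> [x z] []; rewrite /= !in_itv/= oppr0 => xt z0.
have xr0 : x * r0 <= - t by rewrite -ler_pdivlMr// mulNr.
have sz : Num.sqrt (1 - r ^+ 2) * z <= 0 by rewrite mulr_ge0_le0 ?sqrtr_ge0.
have x0 : x <= 0.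
  by apply: le_trans xt _; rewrite oppr_le0 divr_ge0// ltW.
have h1 : x * (1 - r0) <= 0 by rewrite mulr_le0_ge0 ?subr_ge0.
have h2 : x * (r - r0) <= 0 by rewrite mulr_le0_ge0 ?subr_ge0.
split => /=; lra.
Qed.

(** The event is covered by two rectangles. Where [x > - (m * t)], the term [r * x] is at least
    [- ((1 - c) * t)], so the [z] term must supply [- (c * t)]; its coefficient is at most 1, hence
    [z <= - (c * t)]. *)
Lemma gaussian_copula_tail_ub (R : realType) (r t m c : R) : 0 < t ->
  1 <= m -> 0 < c -> r * m <= 1 - c -> c <= 1 ->
  gaussian_copula r (normal_tail t) (normal_tail t) <=
  normal_tail (m * t) + normal_tail t * normal_tail (c * t).
Proof.
move=> t0 m1 c0 rm c1; rewrite -lee_fin gaussian_copula_tailE ?(ltW t0)//.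
rewrite EFinD EFinM -!normal_tailE.
rewrite -[X in (_ <= X + _)%E]mule1.
rewrite -(@probability_setT _ _ _ (normal_prob (0 : R) 1)).
rewrite -!std_normal2X//.
apply: le_trans (measureU2 _ _ _); [|exact: measurableX|exact: measurableX].
apply: le_measure; rewrite ?inE.
- exact: measurable_copula_event.
- by apply: measurableU; exact: measurableX.
- move=> [x z] [/= xt zt].
  have [xm|xm] := leP x (- (m * t)).
    by left; split => //=; rewrite in_itv.
  right; split => /=; rewrite in_itv/=//.
  have s0 := sqrtr_ge0 (1 - r ^+ 2).
  have s1 : Num.sqrt (1 - r ^+ 2) <= 1.
    by rewrite -[leRHS]sqrtr1 ler_wsqrtr// lerBlDr lerDl sqr_ge0.
  (* For [r < 0] the right side is positive, since [x <= - t < 0], and the left side is nonpositive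
     because [c <= 1]. *)
  have rx : - ((1 - c) * t) <= r * x.
    have [r0|r0] := leP 0 r; last by nra.
    apply: (@le_trans _ _ (r * - (m * t))); last by rewrite ler_wpM2l// ltW.
    rewrite mulrN lerN2 mulrA; apply: ler_wpM2r => //; exact: ltW.
  have sz : Num.sqrt (1 - r ^+ 2) * z <= - (c * t) by lra.
  have ct : 0 < c * t by rewrite mulr_gt0.
  move: s0 s1 sz; set s := Num.sqrt _ => s0 s1 sz.
  rewrite leNgt; apply/negP => zc.
  have [z0|z0] := leP 0 z.
    by have := mulr_ge0 s0 z0; lra.
  have : z <= s * z by nra.
  lra.
Qed.

(** * Limits as t tends to infinity, for fixed correlation *)

Lemma expR_quadratic_cvgy (R : realType) (a b c : R) : 0 < a ->
  expR (a * t ^+ 2 + b * t + c) @[t --> +oo] --> +oo.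
Proof.
move=> a0; apply/cvgryPge => M; near=> t.
apply: le_trans (expR_ge1Dx _).
have t1 : 1 <= t by near: t; exact: nbhs_pinfty_ge.
have tM : M <= t by near: t; apply: nbhs_pinfty_ge; exact: num_real.
(* From here on [a * t] exceeds [|b| + |c| + 1], so the quadratic is at least [t]. *)
have ta : (`|b| + `|c| + 1) / a <= t.
  by near: t; apply: nbhs_pinfty_ge; exact: num_real.
rewrite ler_pdivrMr// in ta.
have b0 := ler_norm (- b); rewrite normrN in b0.
have c0 := ler_norm (- c); rewrite normrN in c0.
have cn := normr_ge0 c.
have h1 : (`|b| + `|c| + 1) * t <= t * a * t by rewrite ler_wpM2r//; lra.
have h2 : - b * t <= `|b| * t by rewrite ler_wpM2r//; lra.
have h3 : `|c| <= `|c| * t by rewrite ler_peMr.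
have -> : a * t ^+ 2 = t * a * t by ring.
lra.
Unshelve. all: by end_near. Qed.

Lemma normal_tail_ratio_cvg0 (R : realType) (m : R) : 1 < m ->
  normal_tail (m * t) / normal_tail t @[t --> +oo] --> 0.
Proof.
move=> m1.
have p0 : 0 < normal_peak (1 : R) by rewrite normal_peak_gt0 ?oner_neq0.
(* [q] is the inverse of the quotient of the upper bound for [normal_tail (m * t)] by the lower
   bound for [normal_tail t]; its exponent is m^2 t^2/2 - (t+1)^2/2. *)
pose q t : R := normal_peak 1 *
  expR ((m ^+ 2 - 1) / 2 * t ^+ 2 + (- 1) * t + (- (2^-1))).
have qy : q t @[t --> +oo] --> +oo.
  by apply: gt0_cvgMry => //; apply: expR_quadratic_cvgy; nra.
have q0 t : 0 < q t by rewrite mulr_gt0 ?expR_gt0.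
have qV : (q t)^-1 @[t --> +oo] --> 0.
  by apply/gtr0_cvgV0 => //; exact: nearW.
apply: (squeeze_cvgr _ (cvg_cst 0) qV).
near=> t; have t0 : 0 <= t by near: t; exact: nbhs_pinfty_ge.
rewrite divr_ge0 ?normal_tail_ge0//= ler_pdivrMr ?normal_tail_gt0//.
rewrite [leRHS]mulrC ler_pdivlMr//.
apply: le_trans _ (normal_tail_ge t0).
apply: le_trans (ler_wpM2r (ltW (q0 t)) (normal_tail_le _)) _.
  by rewrite mulr_ge0//; lra.
rewrite /q mulrCA ler_pM2l// -expRD ler_expR; lra.
Unshelve. all: by end_near. Qed.

Lemma normal_tail_cvg0 (R : realType) : normal_tail t @[t --> +oo] --> (0 : R).
Proof.
pose q t : R := expR (2^-1 * t ^+ 2 + 0 * t + 0).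
have qy : q t @[t --> +oo] --> +oo by apply: expR_quadratic_cvgy; lra.
have q0 t : 0 < q t by exact: expR_gt0.
have qV : (q t)^-1 @[t --> +oo] --> 0.
  by apply/gtr0_cvgV0 => //; exact: nearW.
apply: (squeeze_cvgr _ (cvg_cst 0) qV).
near=> t; have t0 : 0 <= t by near: t; exact: nbhs_pinfty_ge.
rewrite normal_tail_ge0/=; apply: le_trans (normal_tail_le t0) _.
by rewrite /q -expRN ler_expR; lra.
Unshelve. all: by end_near. Qed.

Lemma gaussian_tail_ratio_cvg0 (R : realType) (r : R) : -1 < r -> r < 1 ->
  tail_ratio (gaussian_copula r) (normal_tail t) @[t --> +oo] --> 0.
Proof.
move=> rN1 r1.
(* Here [m] solves [m - 1 = 1 - r' * m], and [c] is the common value, positive as [r' < 1].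
   Truncating [r] at 0 keeps [c <= 1]. *)
pose r' := Num.max r 0; pose m := 2 / (1 + r'); pose c := (1 - r') / (1 + r').
have [rr r0 r'1] : [/\ r <= r', 0 <= r' & r' < 1].
  by rewrite /r' le_max lexx le_max lexx orbT gt_max r1 ltr01.
have c0 : 0 < c by rewrite divr_gt0//; lra.
have c1 : c <= 1 by rewrite ler_pdivrMr; lra.
have m1 : 1 < m by rewrite ltr_pdivlMr; lra.
have mc : r' * m = 1 - c by rewrite /m /c; field; lra.
have mcr : r * m <= 1 - c by rewrite -mc ler_wpM2r//; lra.
have H : (normal_tail (m * t) / normal_tail t + normal_tail (c * t))
    @[t --> +oo] --> (0 : R).
  rewrite -[X in _ --> X]addr0.
  apply: cvgD; first exact: normal_tail_ratio_cvg0.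
  apply: (cvg_comp (fun t => c * t) (@normal_tail R)).
    exact: gt0_cvgMry.
  exact: normal_tail_cvg0.
apply: (squeeze_cvgr _ (cvg_cst 0) H).
near=> t; have t0 : 0 < t by near: t; exact: nbhs_pinfty_gt.
have G0 := normal_tail_gt0 (ltW t0).
rewrite /tail_ratio mulr_ge0 ?gaussian_copula_tail_ge0 ?invr_ge0//= ?(ltW G0)
  ?(ltW t0)//.
rewrite mulrC ler_pdivrMr// mulrDl divfK ?gt_eqF//.
rewrite [normal_tail (c * t) * _]mulrC.
by apply: gaussian_copula_tail_ub => //; exact: ltW.
Unshelve. all: by end_near. Qed.

(** * The mixture: integral form, lower bound and tail ratio *)

Lemma measurable_gaussian_copula_tail_comp d (Omega : measurableType d)
    (R : realType) (P : probability Omega R) (rho : {RV P >-> R}) (t : R) :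
  0 <= t ->
  measurable_fun setT
    (fun w => gaussian_copula (rho w) (normal_tail t) (normal_tail t)).
Proof.
by move=> t0; apply: (measurableT_comp (measurable_gaussian_copula_tail t0)).
Qed.

(** The integrand lies between 0 and [normal_tail t], so the expectation is finite and [fine] loses
    nothing. *)
Lemma mixture_copula_tailE d (Omega : measurableType d) (R : realType)
    (P : probability Omega R) (rho : {RV P >-> R}) (t : R) : 0 <= t ->
  (mixture_copula rho (normal_tail t) (normal_tail t))%:E =
  (\int[P]_w (gaussian_copula (rho w) (normal_tail t) (normal_tail t))%:E)%E /\
  0 <= mixture_copula rho (normal_tail t) (normal_tail t) <= normal_tail t.
Proof.
move=> t0; rewrite /mixture_copula unlock.
set I := (\int[P]_w _)%E.
have I0 : (0 <= I)%E.
  by apply: integral_ge0 => w _; rewrite lee_fin gaussian_copula_tail_ge0.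
have I1 : (I <= (normal_tail t)%:E)%E.
  rewrite -[leRHS]mule1 -(@probability_setT _ _ _ P) -integral_cst//.
  apply: ge0_le_integral => //.
  - by move=> w _; rewrite lee_fin gaussian_copula_tail_ge0.
  - by apply/measurable_EFinP; exact: measurable_gaussian_copula_tail_comp.
  - by move=> w _; rewrite lee_fin gaussian_copula_tail_le.
have If : I \is a fin_num by rewrite ge0_fin_numE// (le_lt_trans I1) ?ltry.
by rewrite fineK// -!lee_fin fineK// I0 I1.
Qed.

(** Restrict the expectation to [rho > r0], where the integrand has a lower bound free of [rho]. *)
Lemma mixture_copula_tail_ge d (Omega : measurableType d) (R : realType)
    (P : probability Omega R) (rho : {RV P >-> R}) (r0 t : R) : 0 <= t ->
  0 < r0 -> r0 <= 1 ->
  fine (ccdf rho r0) * (normal_tail (t / r0) * normal_tail 0) <=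
  mixture_copula rho (normal_tail t) (normal_tail t).
Proof.
move=> t0 r00 r01; have [E _] := mixture_copula_tailE rho t0.
rewrite -lee_fin E EFinM fineK ?fin_num_measure//.
rewrite /ccdf /distribution /pushforward.
have mA : measurable (rho @^-1` `]r0, +oo[).
  by rewrite -[X in measurable X]setTI; exact: measurable_funP.
have mK := measurable_gaussian_copula_tail_comp rho t0.
rewrite muleC -integral_cst//.
apply: (@le_trans _ _ (\int[P]_(w in rho @^-1` `]r0, +oo[)
    (gaussian_copula (rho w) (normal_tail t) (normal_tail t))%:E)%E).
  apply: ge0_le_integral => //.
  - by move=> w _; rewrite lee_fin mulr_ge0 ?normal_tail_ge0.
  - by apply/measurable_EFinP; exact: measurable_funTS.
  - move=> w /=; rewrite in_itv/= andbT lee_fin => rw.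
    by apply: gaussian_copula_tail_ge => //; exact: ltW.
apply: ge0_subset_integral => //.
- by apply/measurable_EFinP.
- by move=> w _; rewrite lee_fin gaussian_copula_tail_ge0.
Qed.

Lemma mixture_tail_ratio_cvg0 d (Omega : measurableType d) (R : realType)
    (P : probability Omega R) (rho : {RV P >-> R})
    (rho_range : forall w : Omega, -1 < rho w < 1) :
  tail_ratio (mixture_copula rho) (normal_tail t) @[t --> +oo] --> 0.
Proof.
(* Dominated convergence will run along arbitrary sequences tending to +oo, whose first terms may be
   negative; clamping at 0 makes the bounds valid for every index. *)
pose v t : R := Num.max t 0.
have v0 t : 0 <= v t by rewrite le_max lexx orbT.
have G0 t : 0 < normal_tail (v t) by rewrite normal_tail_gt0.
have vy : v t @[t --> +oo] --> +oo.
  apply/cvgryPge => M; near=> t; rewrite le_max; apply/orP; left.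
  by near: t; apply: nbhs_pinfty_ge; exact: num_real.
suff H : tail_ratio (mixture_copula rho) (normal_tail (v t)) @[t --> +oo] --> 0.
  apply: cvg_trans H; apply: near_eq_cvg; near=> t.
  by rewrite /v max_l//; near: t; exact: nbhs_pinfty_ge.
apply/cvg_pinftyP => u uy.
pose f n w := (tail_ratio (gaussian_copula (rho w)) (normal_tail (v (u n))))%:E.
have f0 n w : (0 <= f n w)%E.
  by rewrite lee_fin mulr_ge0 ?gaussian_copula_tail_ge0 ?invr_ge0 ?(ltW (G0 _)).
have mf n : measurable_fun setT (f n).
  apply/measurable_EFinP; apply: measurable_funM => //.
  exact: measurable_gaussian_copula_tail_comp.
have [|||||_ _] :=
  @dominated_convergence _ _ _ P setT measurableT f (cst 0%E) (cst 1%E).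
- exact: mf.
- exact: measurable_cst.
- apply: aeW => w _; have /andP[w0 w1] := rho_range w.
  apply: cvg_EFin; first exact: nearW.
  apply: (cvg_comp (v \o u)
    (fun t => tail_ratio (gaussian_copula (rho w)) (normal_tail t))).
    exact: cvg_comp uy vy.
  exact: gaussian_tail_ratio_cvg0.
- exact: finite_measure_integrable_cst.
- apply: aeW => w n _; rewrite gee0_abs// lee_fin.
  by rewrite /tail_ratio mulrC ler_pdivrMr// mul1r gaussian_copula_tail_le.
rewrite integral0 => /fine_cvg; apply: cvg_trans; apply: near_eq_cvg.
apply: nearW => n /=.
(* The factor [(normal_tail _)^-1] does not depend on [w] and leaves the integral, which turns it
   into the tail ratio of the mixture. *)
rewrite /f; under eq_integral do rewrite EFinM.
have [E _] := mixture_copula_tailE rho (v0 (u n)).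
rewrite ge0_integralZl//=.
- by rewrite -E.
- by apply/measurable_EFinP; exact: measurable_gaussian_copula_tail_comp.
- by move=> w _; rewrite lee_fin gaussian_copula_tail_ge0.
- by rewrite lee_fin invr_ge0 normal_tail_ge0.
Unshelve. all: by end_near. Qed.

(** Some [y > x] has [cdf X y < 1], hence positive survival probability, and survival at [x] is no
    smaller. *)
Lemma ccdf_gt0 d (Omega : measurableType d) (R : realType)
    (P : probability Omega R) (X : {RV P >-> R}) (x : R) :
  (x%:E < upper_endpoint X)%E -> 0 < fine (ccdf X x).
Proof.
move=> /ereal_sup_gt[_ [y /= y1 <-]]; rewrite lte_fin => xy.
rewrite fine_gt0//; apply/andP; split; last first.
  by rewrite (le_lt_trans (probability_le1 _ _)) ?ltry.
apply: lt_le_trans (ccdf_nonincreasing X (ltW xy)).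
by rewrite ccdf_1_cdf sube_gt0.
Qed.

Lemma cvg_at_right_comp_normal_tail (R : realType) (T : Type)
    (f : R -> T) (F : set_system T) :
  f (normal_tail t) @[t --> +oo] --> F -> f u @[u --> 0^'+] --> F.
Proof. by move=> H A /H; exact: cvg_at_right_normal_tail. Qed.

Lemma mixture_tail_ratio_cvgy d (Omega : measurableType d) (R : realType)
    (P : probability Omega R) (rho : {RV P >-> R}) (eps : R) :
  (1%:E <= upper_endpoint rho)%E -> 0 < eps ->
  normal_tail t `^ (- eps) * tail_ratio (mixture_copula rho) (normal_tail t)
    @[t --> +oo] --> +oo.
Proof.
(* [k] is the inverse of the threshold r0. Its square lies strictly between 1 and [1 + eps]: the
   first puts r0 below the upper endpoint, the second leaves a positive quadratic term. *)
move=> rho1 eps0; pose k := Num.sqrt (1 + eps / 2).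
have kk : k ^+ 2 = 1 + eps / 2 by rewrite sqr_sqrtr//; lra.
have k1 : 1 < k.
  by rewrite -[ltLHS]sqrtr1 ltr_sqrt; lra.
have k0 : 0 < k by lra.
have kV0 : 0 < k^-1 by rewrite invr_gt0.
have kV1 : k^-1 < 1 by rewrite invf_lt1.
have p0 : 0 < fine (ccdf rho k^-1).
  by apply: ccdf_gt0; apply: lt_le_trans rho1; rewrite lte_fin.
set p := fine _ in p0.
have q0 : 0 < normal_peak (1 : R) by rewrite normal_peak_gt0 ?oner_neq0.
(* The leading coefficient is (1 + eps - k^2)/2 = eps/4; the other two come from expanding
   (kt+1)^2/2. *)
have By : p * normal_tail 0 * normal_peak 1 *
    expR (eps / 4 * t ^+ 2 + (- k) * t + (- (2^-1))) @[t --> +oo] --> +oo.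
  apply: gt0_cvgMry; first by rewrite !mulr_gt0// normal_tail_gt0.
  by apply: expR_quadratic_cvgy; lra.
apply: ger_cvgy By; near=> t.
have t0 : 0 <= t by near: t; exact: nbhs_pinfty_ge.
have G0 := normal_tail_gt0 t0.
have lnG : ln (normal_tail t) <= - (t ^+ 2 / 2).
  by rewrite -[leRHS]expRK ler_ln ?posrE ?expR_gt0// normal_tail_le.
have e1 : expR (eps * (t ^+ 2 / 2)) <= normal_tail t `^ (- eps).
  by rewrite /powR gt_eqF// ler_expR; nra.
have e2 : expR (t ^+ 2 / 2) <= (normal_tail t)^-1.
  by rewrite -[leRHS]lnK ?posrE ?invr_gt0// ler_expR lnV ?posrE//; lra.
have e3 := normal_tail_ge (mulr_ge0 (ltW k0) t0).
have e4 := mixture_copula_tail_ge rho t0 kV0 (ltW kV1).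
rewrite invrK -/p [t * k]mulrC in e4.
(* The exponent is split into three summands, to be matched with the bounds [e1], [e2] and [e3]. *)
have -> : eps / 4 * t ^+ 2 + - k * t + - 2^-1 =
    eps * (t ^+ 2 / 2) + (t ^+ 2 / 2 + - ((k * t + 1) ^+ 2 / 2)).
  have -> : (k * t + 1) ^+ 2 = k ^+ 2 * t ^+ 2 + 2 * k * t + 1 by ring.
  by rewrite kk; field.
rewrite 2!expRD [leLHS]mulrCA; apply: ler_pM => //; rewrite ?expR_ge0//.
  by rewrite !mulr_ge0 ?expR_ge0 ?normal_tail_ge0 ?(ltW p0) ?(ltW q0).
rewrite /tail_ratio [leLHS]mulrCA; apply: ler_pM => //; rewrite ?expR_ge0//.
  by rewrite !mulr_ge0 ?expR_ge0 ?normal_tail_ge0 ?(ltW p0) ?(ltW q0).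
apply: le_trans e4.
have -> : p * normal_tail 0 * normal_peak 1 * expR (- ((k * t + 1) ^+ 2 / 2)) =
  p * (normal_peak 1 * expR (- ((k * t + 1) ^+ 2 / 2)) * normal_tail 0) by ring.
by rewrite ler_pM2l// ler_pM2r// normal_tail_gt0.
Unshelve. all: by end_near. Qed.

(** * The Ledford-Tawn index and the conclusion *)

Lemma ledford_tawn_ratio_cvg1 (R : realType) (C : R -> R -> R) :
  (\forall u \near 0^'+, C u u <= u) ->
  (forall eps, 0 < eps ->
    u `^ (- eps) * tail_ratio C u @[u --> 0^'+] --> +oo) ->
  ledford_tawn_ratio C u @[u --> 0^'+] --> (1 : R).
Proof.
move=> Cu Cy; apply/cvgrPdist_le => e e0; near=> u.
have u0 : 0 < u by near: u; exact: nbhs_right_gt.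
have u1 : u < 1 by near: u; exact: nbhs_right_lt.
have Cuu : C u u <= u by near: u.
have H : 1 <= u `^ (- e) * tail_ratio C u.
  by near: u; apply: cvgry_ge; exact: Cy.
(* Positivity must be secured before taking logarithms; it follows from [H], whose right side would
   otherwise be nonpositive. *)
have C0 : 0 < C u u.
  rewrite ltNge; apply/negP => C0.
  have : u `^ (- e) * (u^-1 * C u u) <= 0.
    by rewrite mulr_ge0_le0 ?powR_ge0// mulr_ge0_le0// invr_ge0 ltW.
  by move: H; rewrite /tail_ratio; lra.
have L0 : ln u < 0 by rewrite ln_lt0// u0.
have DL : ln (C u u) <= ln u by rewrite ler_ln ?posrE.
(* This is the logarithm of u^(1+e) <= C(u, u), a rearrangement of [H]. *)
have De : (1 + e) * ln u <= ln (C u u).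
  move: H; rewrite -ler_ln ?posrE//; last first.
    by rewrite /tail_ratio !mulr_gt0 ?powR_gt0 ?invr_gt0.
  rewrite ln1 /tail_ratio !lnM ?posrE ?mulr_gt0 ?powR_gt0 ?invr_gt0//.
  by rewrite ln_powR lnV ?posrE//; lra.
rewrite /ledford_tawn_ratio; set L := ln u in L0 DL De *.
set D := ln _ in DL De *.
have D0 : D < 0 by lra.
(* Since [D <= L < 0], the numerator satisfies L - D <= -e L <= -e D. *)
have -> : 1 - L / D = (L - D) / - D by field; lra.
rewrite ger0_norm; last by rewrite divr_ge0//; lra.
by rewrite ler_pdivrMr; nra.
Unshelve. all: by end_near. Qed.

Theorem proposition4 (R : realType) (d : measure_display)
    (Omega : measurableType d) (P : probability Omega R) (rho : {RV P >-> R})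
    (rho_range : forall w : Omega, -1 < rho w < 1)
    (rho_lt1 : {ae P, forall w, rho w < 1})
    (rho_endpoint : upper_endpoint rho = 1%:E) :
  let C := mixture_copula rho in
  [/\ forall eps : R, 0 < eps ->
        (u `^ (- eps) * tail_ratio C u) @[u --> 0^'+] --> +oo,
      tail_ratio C u @[u --> 0^'+] --> 0,
      cvg (ledford_tawn_ratio C u @[u --> 0^'+]),
      ledford_tawn_index C = 1 &
      chi_bar C = 1].
Proof.
move=> C.
have Cy eps : 0 < eps -> u `^ (- eps) * tail_ratio C u @[u --> 0^'+] --> +oo.
  move=> eps0; apply: (@cvg_at_right_comp_normal_tail R R
    (fun u => u `^ (- eps) * tail_ratio C u)).
  by apply: mixture_tail_ratio_cvgy => //; rewrite rho_endpoint.
(* The bound is known only at values of [normal_tail]; the substitution carries it to all small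
   [u]. *)
have Cle : \forall u \near 0^'+, C u u <= u.
  apply: cvg_at_right_normal_tail.
  suff: \forall t \near +oo, C (normal_tail t) (normal_tail t) <= normal_tail t.
    by [].
  near=> t.
  have t0 : 0 <= t by near: t; exact: nbhs_pinfty_ge.
  by have [_ /andP[]] := mixture_copula_tailE rho t0.
have C1 := ledford_tawn_ratio_cvg1 Cle Cy.
have eta1 : ledford_tawn_index C = 1 by exact/cvg_lim.
split => //.
- apply: (@cvg_at_right_comp_normal_tail R R (tail_ratio C)).
  exact: mixture_tail_ratio_cvg0.
- by apply/cvg_ex; exists 1.
- by rewrite /chi_bar eta1; ring.
Unshelve. all: by end_near. Qed.
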